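(* Let $X\in\{LD,LTD,OLD\}$. Let $G$ be a graph that is either a path $P_n$ or a cycle $C_n$ and that admits an $X$-set. Then $\gamma_X(M(G)) \geq \gamma_X(G)+1$.
   Context: All graphs are finite, simple and connected. For a graph $G=(V,E)$ and $x\in V$, $N(x)$ is the open neighbourhood and $N[x]=N(x)\cup\{x\}$. A set $C\subseteq V$ is dominating if $N[x]\cap C\ne\emptyset$ for all $x\in V$, and total-dominating if $N(x)\cap C\neq\emptyset$ for all $x\in V$. $C$ is a locating-dominating set ($LD$-set) if it is dominating and $N(x)\cap C\ne N(y)\cap C$ for all distinct $x,y\in V\setminus C$; a locating total-dominating set ($LTD$-set) if it is total-dominating and $N(x)\cap C\ne N(y)\cap C$ for all distinct $x,y\in V\setminus C$; an open locating-dominating set ($OLD$-set) if it is total-dominating and $N(x)\cap C\neq N(y)\cap C$ for all distinct $x,y\in V$. For $X\in\{LD,LTD,OLD\}$, $\gamma_X(G)$ is the minimum size of an $X$-set of $G$. $P_n$ is the path on $n$ vertices and $C_n$ ($n\ge 3$) the cycle on $n$ vertices. The Mycielski graph $M(G)$ of $G$ with $V=\{v_1,\dots,v_n\}$ is obtained from $G$ by adding, for each $i$, a new vertex $u_i$ adjacent to every vertex of $N_G(v_i)$, and then adding one further vertex $u$ adjacent to all of $u_1,\dots,u_n$ (and to nothing else). *)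

(* Defs.v *)
From mathcomp Require Import all_boot.

Set Implicit Arguments.
Unset Strict Implicit.
Unset Printing Implicit Defensive.

(* Finite simple graphs. Connectedness is not a field: paths and cycles have it,
   and the Mycielski graph of the one-vertex graph does not. *)
Record sgraph := SGraph {
  vertex :> finType;
  adj : rel vertex;
  adj_sym : symmetric adj;
  adj_irr : irreflexive adj }.

Definition giso (G H : sgraph) : Prop :=
  exists2 f : G -> H, bijective f & forall x y, adj (f x) (f y) = adj x y.

Definition open_nbh (G : sgraph) (x : G) : {set G} := [set y | adj x y].
Definition closed_nbh (G : sgraph) (x : G) : {set G} := x |: open_nbh x.

Definition dominating (G : sgraph) (C : {set G}) : bool :=
  [forall x, closed_nbh x :&: C != set0].

Definition total_dominating (G : sgraph) (C : {set G}) : bool :=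
  [forall x, open_nbh x :&: C != set0].

(* The members of A have pairwise distinct traces of open neighbourhoods on C. *)
Definition separates (G : sgraph) (C A : {set G}) : bool :=
  [forall x in A, forall y in A,
     (x != y) ==> (open_nbh x :&: C != open_nbh y :&: C)].

Inductive set_kind := LD | LTD | OLD.

Definition is_Xset (X : set_kind) (G : sgraph) (C : {set G}) : bool :=
  match X with
  | LD => dominating C && separates C (~: C)
  | LTD => total_dominating C && separates C (~: C)
  | OLD => total_dominating C && separates C [set: G]
  end.

Definition admits_Xset (X : set_kind) (G : sgraph) : Prop :=
  exists C : {set G}, is_Xset X C.

(* The value is 0 when G has no X-set. Hence a positive lower bound on
   gamma X G entails that G has an X-set. *)
Definition gamma (X : set_kind) (G : sgraph) : nat :=
  if [pick C : {set G} | is_Xset X C] is Some C0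
  then #|[arg min_(C < C0 | is_Xset X C) #|C| ]|
  else 0.

Lemma gammaP X G : admits_Xset X G ->
  (exists2 C : {set G}, is_Xset X C & #|C| = gamma X G) /\
  (forall C : {set G}, is_Xset X C -> gamma X G <= #|C|).
Proof.
rewrite /gamma => -[C1 XC1]; case: pickP => [C0 XC0|/(_ C1)]; last by rewrite XC1.
by case: arg_minnP => // C XC minC; split=> //; exists C.
Qed.

Definition path_adj (n : nat) : rel 'I_n :=
  fun i j => (i.+1 == j :> nat) || (j.+1 == i :> nat).

Lemma path_adj_sym n : symmetric (@path_adj n).
Proof. by move=> i j; rewrite /path_adj orbC. Qed.

Lemma path_adj_irr n : irreflexive (@path_adj n).
Proof. by move=> i; rewrite /path_adj orbb; apply/negbTE; rewrite gtn_eqF. Qed.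

Definition path_graph (n : nat) : sgraph :=
  SGraph (@path_adj_sym n) (@path_adj_irr n).

(* ordS is the cyclic successor on 'I_n. The conjunct i != j only matters for
   n = 1, where it excludes a loop. *)
Definition cycle_adj (n : nat) : rel 'I_n :=
  fun i j => (i != j) && ((ordS i == j) || (ordS j == i)).

Lemma cycle_adj_sym n : symmetric (@cycle_adj n).
Proof. by move=> i j; rewrite /cycle_adj eq_sym orbC. Qed.

Lemma cycle_adj_irr n : irreflexive (@cycle_adj n).
Proof. by move=> i; rewrite /cycle_adj eqxx. Qed.

Definition cycle_graph (n : nat) : sgraph :=
  SGraph (@cycle_adj_sym n) (@cycle_adj_irr n).

Definition is_path (G : sgraph) : Prop :=
  exists2 n : nat, 1 <= n & giso G (path_graph n).

Definition is_cycle (G : sgraph) : Prop :=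
  exists2 n : nat, 3 <= n & giso G (cycle_graph n).

(* Some (inl v) is the vertex v of G, Some (inr v) is the new vertex attached to
   the neighbours of v, and None is the last vertex u. *)
Definition mycielski_adj (G : sgraph) : rel (option (G + G)) :=
  fun a b =>
  match a, b with
  | Some (inl v), Some (inl w) => adj v w
  | Some (inl v), Some (inr w) => adj w v
  | Some (inr v), Some (inl w) => adj v w
  | Some (inr _), None => true
  | None, Some (inr _) => true
  | _, _ => false
  end.

Lemma mycielski_adj_sym (G : sgraph) : symmetric (@mycielski_adj G).
Proof. by move=> [[v|v]|] [[w|w]|] //=; rewrite adj_sym. Qed.

Lemma mycielski_adj_irr (G : sgraph) : irreflexive (@mycielski_adj G).
Proof. by move=> [[v|v]|] //=; rewrite adj_irr. Qed.

Definition mycielski (G : sgraph) : sgraph :=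
  SGraph (@mycielski_adj_sym G) (@mycielski_adj_irr G).

(* Main.v *)
Require Import Defs.
From mathcomp Require Import all_boot.
From mathcomp Require Import zify.

Set Implicit Arguments.
Unset Strict Implicit.

(** Write an X-set D of M(G) as A (its trace on V), B (the indices of its trace
on the new copies) and possibly the apex u. The copies see only A and u, so A
separates the vertices outside B, and all vertices in the OLD case. As u must be
dominated, u lies in D or B is nonempty. If u lies in D, or if A meets B, then
A ∪ B is an X-set of G (X = LD, LTD) of size less than |D|. Otherwise drop an
arbitrary b from A ∪ B: a vertex i confused with b would share with b a
neighbour a in A, and a itself needs a neighbour in A, so a would have degree at
least 3. For OLD, A misses at most one vertex, so A plus at most one element of
B is enough. *)

(** * Pointwise forms of domination and separation *)

Lemma total_dominatingP (G : sgraph) (C : {set G}) :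
  reflect (forall x, exists2 y, adj x y & y \in C) (total_dominating C).
Proof.
apply: (iffP forallP) => h x.
  by have /set0Pn[y /setIP[]] := h x; rewrite inE; exists y.
by have [y xy yC] := h x; apply/set0Pn; exists y; rewrite !inE xy.
Qed.

Lemma dominatingP (G : sgraph) (C : {set G}) :
  reflect (forall x, x \notin C -> exists2 y, adj x y & y \in C)
          (dominating C).
Proof.
apply: (iffP forallP) => [h x xC | h x].
  have /set0Pn[y /setIP[]] := h x; rewrite !inE => /orP[/eqP->|xy yC].
    by rewrite (negbTE xC).
  by exists y.
apply/set0Pn; case: (boolP (x \in C)) => [xC | /h[y xy yC]].
  by exists x; rewrite !inE eqxx.
by exists y; rewrite !inE xy yC orbT.
Qed.

Lemma separatesP (G : sgraph) (C S : {set G}) :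
  reflect {in S &, forall x y, {in C, adj x =1 adj y} -> x = y}
          (separates C S).
Proof.
apply: (iffP idP) => [h x y xS yS e | h].
  have /forall_inP/(_ _ xS)/forall_inP/(_ _ yS) := h.
  case: (eqVneq x y) => //= _ /eqP[]; apply/setP => z; rewrite !inE.
  by case: (boolP (z \in C)) => [/e->|]; rewrite ?andbF.
apply/forall_inP => x xS; apply/forall_inP => y yS; apply/implyP.
apply: contra_neq => /setP e; apply: h => // z zC.
by have := e z; rewrite !inE zC !andbT.
Qed.

(** * Degrees in paths and cycles *)

Definition max_degree2 (G : sgraph) : Prop :=
  forall a b c d : G, adj a b -> adj a c -> adj a d -> b != c ->
  d \in [:: b; c].

(** This bound and nonemptiness are all that the proof uses of paths and cycles. *)
Lemma max_degree2_path_or_cycle (G : sgraph) :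
  is_path G \/ is_cycle G -> max_degree2 G.
Proof.
have transfer H : giso G H -> max_degree2 H -> max_degree2 G.
  case=> f /bij_inj fI fA dH a b c d ab ac ad bc.
  have := dH (f a) (f b) (f c) (f d).
  by rewrite !fA !inE !(inj_eq fI); apply.
case=> -[n _ /transfer]; apply=> a b c d /=.
  by rewrite /path_adj !inE -!val_eqE /=; lia.
rewrite /cycle_adj !inE.
move=> /andP[_ ab] /andP[_ ac] /andP[_ ad] /eqP bc.
apply/negPn/negP => /norP[/eqP db /eqP dc]; have I := @ordS_inj n.
(* Each of [b], [c], [d] is a successor or a predecessor of [a]. Two of them are on the same side
   and coincide, since [ordS] is an injective function. *)
case/orP: ab => /eqP ab; case/orP: ac => /eqP ac; case/orP: ad => /eqP ad;
  by first [ apply: bc; congruence | apply: db; congruence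
           | apply: dc; congruence | apply/bc/I; congruence
           | apply/db/I; congruence | apply/dc/I; congruence ].
Qed.

Lemma card_vertex_gt0_path_or_cycle (G : sgraph) :
  is_path G \/ is_cycle G -> 0 < #|G|.
Proof.
case=> -[n n_gt [f /bij_eq_card]]; rewrite card_ord => ->; lia.
Qed.

(** * Traces of a vertex set of the Mycielski graph *)

Definition old_trace {G : sgraph} (D : {set mycielski G}) : {set G} :=
  [set v | Some (inl v) \in D].
Definition new_trace {G : sgraph} (D : {set mycielski G}) : {set G} :=
  [set v | Some (inr v) \in D].

Lemma card_traces (G : sgraph) (D : {set mycielski G}) :
  #|D| = #|old_trace D| + #|new_trace D| + (None \in D).
Proof.
pose l (v : G) : mycielski G := Some (inl v).
pose r (v : G) : mycielski G := Some (inr v).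
have lI : injective l by move=> x y [].
have rI : injective r by move=> x y [].
rewrite (cardsD1 None) addnC; congr (_ + _).
rewrite -(card_imset (old_trace D) lI) -(card_imset (new_trace D) rI).
have -> : D :\ None = l @: old_trace D :|: r @: new_trace D.
  apply/setP => -[[v|v]|]; rewrite !inE /=.
  - rewrite -[Some (inl v)]/(l v) mem_imset // inE.
    by case: imsetP => [[] //|_]; rewrite orbF.
  - rewrite -[Some (inr v)]/(r v) [in RHS]orbC mem_imset // inE.
    by case: imsetP => [[] //|_]; rewrite orbF.
  - by symmetry; apply/norP; split; apply/imsetP => -[].
rewrite cardsU disjoint_setI0 ?cards0 ?subn0 //.
by apply/pred0P => z; apply/andP => -[/imsetP[v _ ->] /imsetP[]].
Qed.

(** * Existence of X-sets in the Mycielski graph *)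

Lemma mycielski_total_dominatingT (G : sgraph) (C : {set G}) :
  0 < #|G| -> total_dominating C -> total_dominating [set: mycielski G].
Proof.
move=> /card_gt0P[v0 _] /total_dominatingP tC; apply/total_dominatingP.
case=> [[v|v]|].
- by have [w vw _] := tC v; exists (Some (inl w)).
- by exists None.
- by exists (Some (inr v0)).
Qed.

(** Rules out the default value 0 of [gamma] on the Mycielski graph. In the OLD case the apex tells
    a copy from any vertex that is not a copy, and a neighbour in [G] of an old vertex tells that
    vertex from the apex. *)
Lemma admits_Xset_mycielski (X : set_kind) (G : sgraph) :
  0 < #|G| -> admits_Xset X G -> admits_Xset X (mycielski G).
Proof.
move=> G0 [C XC]; exists setT.
have sT : separates [set: mycielski G] (~: setT).
  by apply/separatesP => x y; rewrite !inE.
case: X XC => /=.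
- by move=> _; rewrite sT andbT; apply/dominatingP => x; rewrite inE.
- by case/andP=> tC _; rewrite sT (mycielski_total_dominatingT G0 tC).
case/andP=> tC /separatesP sC; rewrite (mycielski_total_dominatingT G0 tC) //=.
move/total_dominatingP: tC => tC.
apply/separatesP => -[[v|v]|] [[w|w]|] _ _ e //.
- congr (Some (inl _)); apply: sC; rewrite ?inE // => z _.
  exact: (e (Some (inl z))).
- by have := e None (in_setT _).
- by have [z vz _] := tC v; have := e (Some (inl z)) (in_setT _); rewrite /= vz.
- by have := e None (in_setT _).
- congr (Some (inr _)); apply: sC; rewrite ?inE // => z _.
  exact: (e (Some (inl z))).
- by have := e None (in_setT _).
- by have [z vz _] := tC w; have := e (Some (inl z)) (in_setT _); rewrite /= vz.
- by have := e None (in_setT _).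
Qed.

(** * Passing domination and separation to the traces *)

Lemma separates_subset (G : sgraph) (C C' S S' : {set G}) :
  C \subset C' -> S' \subset S -> separates C S -> separates C' S'.
Proof.
move=> /subsetP subC /subsetP subS /separatesP sC.
apply/separatesP => x y xS yS e.
by apply: sC; rewrite ?subS // => z /subC; apply: e.
Qed.

(** The apex is adjacent to every copy, so it never tells two copies apart, and copies are not
    adjacent to each other. *)
Lemma new_copies_separates (G : sgraph) (D : {set mycielski G})
    (S : {set mycielski G}) :
  separates D S -> separates (old_trace D) (new_trace S).
Proof.
move=> /separatesP sD; apply/separatesP => x y; rewrite !inE => xS yS e.
suff [] : Some (inr x) = Some (inr y) :> mycielski G by [].
apply: sD => // -[[z|z]|] zD //; apply: e; by rewrite inE.
Qed.

Lemma apex_dominated (G : sgraph) (D : {set mycielski G}) :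
  dominating D -> None \notin D -> exists b, b \in new_trace D.
Proof.
move=> /dominatingP dD /dD[[[v|v]|] //= _ vD].
by exists v; rewrite inE.
Qed.

Lemma total_dominating_dominating (G : sgraph) (C : {set G}) :
  total_dominating C -> dominating C.
Proof. by move=> /total_dominatingP tC; apply/dominatingP => x _. Qed.

(** The hypothesis concerns a single vertex, here and in [old_dominated], so that it can come from
    domination, for a vertex outside [D], or from total domination. *)
Lemma copy_dominated (G : sgraph) (D : {set mycielski G}) (v : G) :
  None \notin D ->
  (exists2 y, adj (Some (inr v) : mycielski G) y & y \in D) ->
  exists2 a, adj v a & a \in old_trace D.
Proof.
move=> /negPf ND [[[z|z]|] //= vz zD]; last by rewrite ND in zD.
by exists z; rewrite ?inE.
Qed.

Lemma old_dominated (G : sgraph) (D : {set mycielski G}) (v : G) :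
  (exists2 y, adj (Some (inl v) : mycielski G) y & y \in D) ->
  exists2 a, adj v a & a \in old_trace D :|: new_trace D.
Proof.
case=> [[[z|z]|] //= vz zD]; exists z; rewrite ?inE ?zD ?orbT //.
by rewrite adj_sym.
Qed.

(** * Smaller X-sets in the original graph *)

Lemma OLD_mycielski (G : sgraph) (D : {set mycielski G}) :
  is_Xset OLD D -> exists2 C : {set G}, is_Xset OLD C & #|C| < #|D|.
Proof.
case/andP=> tD sD.
have sA : separates (old_trace D) [set: G].
  have -> : [set: G] = new_trace setT by apply/setP => x; rewrite !inE.
  exact: new_copies_separates.
move/total_dominatingP: tD => tD.
have B0 : 0 < #|new_trace D|.
  have [[[v|v]|] //= _ vD] := tD None.
  by apply/card_gt0P; exists v; rewrite inE.
case: (boolP (total_dominating (old_trace D))) => [tA | ntA].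
  by exists (old_trace D); [apply/andP | rewrite card_traces; lia].
have ND : None \in D.
  apply: contraNT ntA => ND; apply/total_dominatingP => v.
  exact: copy_dominated (tD _).
move: ntA; rewrite negb_forall => /existsP[i]; rewrite negbK => /eqP iA.
have iA' z : adj i z -> z \notin old_trace D.
  move=> iz; apply/negP => zA.
  by have := in_set0 z; rewrite -iA inE zA inE iz.
have [b ib] := old_dominated (tD (Some (inl i))).
rewrite inE (negPf (iA' b ib)) => /= bB.
(* [D] contains both the apex and a copy, which leaves room for one extra vertex. *)
exists (b |: old_trace D); last first.
  rewrite cardsU1 card_traces ND; lia.
rewrite /is_Xset (separates_subset (subsetUr _ _) (subxx _) sA) andbT.
apply/total_dominatingP => v; case: (eqVneq v i) => [->|vi].
  by exists b; rewrite // !inE eqxx.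
(* If [v] had no neighbour in the old trace either, [v] and [i] would both have the empty trace on
   it. *)
case: (set_0Vmem (open_nbh v :&: old_trace D)) => [vA|[a]].
  case/eqP: vi; move/separatesP: sA; apply; rewrite ?inE // => z zA.
  apply/idP/idP => [vz | /iA']; last by rewrite zA.
  by have := in_set0 z; rewrite -vA inE zA inE vz.
by rewrite 2!inE => /andP[va aA]; exists a => //; rewrite inE aA orbT.
Qed.

Lemma LD_or_LTD_mycielski (X : set_kind) (G : sgraph) (D : {set mycielski G}) :
  max_degree2 G -> X <> OLD -> is_Xset X D ->
  exists2 C : {set G}, is_Xset X C & #|C| < #|D|.
Proof.
move=> deg2 XnOLD XD; set A := old_trace D; set B := new_trace D.
have [dD sD] : dominating D /\ separates D (~: D).
  by case: X XnOLD XD => //= _ /andP[]; move=> // /total_dominating_dominating.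
have Xdom (C : {set G}) : separates C (~: C) -> dominating C ->
    (X = LTD -> total_dominating C) -> is_Xset X C.
  by case: X XnOLD XD => //= _ _ -> dC tC; rewrite ?dC ?tC.
have tD : X = LTD -> total_dominating D.
  by move=> XE; move: XD; rewrite XE => /andP[].
have sA : separates A (~: B).
  have -> : ~: B = new_trace (~: D) by apply/setP => x; rewrite !inE.
  exact: new_copies_separates.
have domAB v : v \notin A -> exists2 a, adj v a & a \in A :|: B.
  by rewrite inE => vA; apply/old_dominated/(dominatingP _ dD).
case: (boolP ((None \in D) || (A :&: B != set0))) => [short | /norP[ND]].
  exists (A :|: B).
    apply: Xdom.
    - by apply: separates_subset sA; rewrite ?subsetUl ?setCS ?subsetUr.
    - by apply/dominatingP => v; rewrite inE => /norP[/domAB].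
    - move=> /tD/total_dominatingP tAB.
      by apply/total_dominatingP => v; apply: old_dominated.
  rewrite cardsU card_traces -/A -/B; move: short; rewrite -card_gt0.
  (* The subtraction from [cardsU] is truncated; with this bound it really saves the size of the
     intersection. *)
  have : #|A :&: B| <= #|A| by rewrite subset_leq_card ?subsetIl.
  by case: (None \in D) => /=; lia.
rewrite negbK setI_eq0 => AB0.
have BnA z : z \in B -> z \notin A by move=> zB; rewrite (disjointFl AB0 zB).
have domA v : v \notin B -> exists2 a, adj v a & a \in A.
  rewrite inE => vB; apply: copy_dominated => //.
  exact: (dominatingP _ dD).
(* A vertex of A adjacent to both b and i has its own A-neighbour as a third
   neighbour. *)
have no_confusion b i : b \in B -> i \notin A -> i \notin B ->
    {in A, adj b =1 adj i} -> False.
  move=> bB iA iB e; have [a ia aA] := domA _ iB.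
  have [|c ac cA] := domA a; first by rewrite (disjointFr AB0 aA).
  have bi : b != i by apply: contraNneq iB => <-.
  have := deg2 a b i c; rewrite ![adj a _]adj_sym e // ia adj_sym ac bi.
  move=> /(_ isT isT isT isT); rewrite !inE => /orP[]/eqP cE; move: cA.
    by rewrite cE (negPf (BnA _ bB)).
  by rewrite cE (negPf iA).
have [b bB] := apex_dominated dD ND.
have bA := BnA b bB.
have AC : A \subset (A :|: B) :\ b by rewrite subsetD1 subsetUl bA.
exists ((A :|: B) :\ b); last first.
  have bAB : b \in A :|: B by rewrite inE bB orbT.
  rewrite card_traces -/A -/B; move: (cardsD1 b (A :|: B)); rewrite bAB cardsU.
  by move=> /=; lia.
apply: Xdom.
- apply/separatesP => x y.
  rewrite !in_setC !in_setD1 !in_setU !negb_and !negbK => xC yC e.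
  have eA : {in A, adj x =1 adj y} by move=> z /(subsetP AC)/e.
  (* A vertex outside the new set is either [b] or outside both [A] and [B]. *)
  case/orP: xC yC => [/eqP xb|/norP[xA xB]] /orP[/eqP yb|/norP[yA yB]].
  + by rewrite xb yb.
  + by case: (no_confusion x y); rewrite ?xb // => z zA; rewrite -xb eA.
  + by case: (no_confusion y x); rewrite ?yb // => z zA; rewrite -yb eA.
  + by move/separatesP: sA; apply; rewrite // in_setC.
- apply/dominatingP => v; case: (eqVneq v b) => [-> _|vb].
    (* The old vertex [b] is not in [D], so it has a neighbour in the union, which survives the
       removal because there are no loops. *)
    have [a ba aAB] := domAB b bA; exists a; rewrite // in_setD1 aAB andbT.
    by apply: contraTneq ba => ->; rewrite adj_irr.
  rewrite in_setD1 vb inE => /norP[_ /domA[a va aA]].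
  by exists a; rewrite // (subsetP AC).
- move=> /tD/total_dominatingP tM; apply/total_dominatingP => v.
  (* Under total domination the copy of [v] needs a neighbour even if it lies in [D]. This neighbour
     is in [A], hence different from [b]. *)
  have [a va aA] := copy_dominated ND (tM (Some (inr v))).
  by exists a; rewrite // (subsetP AC).
Qed.

Unset Implicit Arguments.

Theorem theorem1 (X : set_kind) (G : sgraph)
  (hG : is_path G \/ is_cycle G) (hX : admits_Xset X G) :
  gamma X (mycielski G) >= gamma X G + 1.
Proof.
have deg2 := max_degree2_path_or_cycle hG.
have G0 := card_vertex_gt0_path_or_cycle hG.
have [[D XD <-] _] := gammaP (admits_Xset_mycielski G0 hX).
have [_ minG] := gammaP hX.
suff [C /minG leC ltC] : exists2 C : {set G}, is_Xset X C & #|C| < #|D|.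
  by rewrite addn1; apply: leq_ltn_trans ltC.
by case: X XD {hX minG} => XD;
  [apply: LD_or_LTD_mycielski | apply: LD_or_LTD_mycielski
  | apply: OLD_mycielski].
Qed.
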